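(* Let $a,b\in\mathbb F_q^*$, $\mathbf A=(A(a),A(b))$ and $c=ab^{-1}$. Let $n\ge0$ and let $g\in F_n\setminus\{0\}$, written as $g=y^nf\left(\frac{x}{y}\right)$ with $f\in\mathbb F_q[t]$ of degree at most $n$. Then $g\in F_n(\mathbf A)$ if and only if $$b^{-n}f(t)=f(ct).$$ In particular, for $n\ge2$, $g$ is irreducible and $g\in F_n(\mathbf A)$ if and only if $f(t)\in\mathbb F_q[t]$ is irreducible of degree $n$, $b^n=1$ and $f(t)=f(ct)$.
   Context: $\mathbb F_q$ is the finite field with $q$ elements, $q$ a prime power. For $a\in\mathbb F_q^*$, $A(a)=\begin{pmatrix}a&0\\0&1\end{pmatrix}$. The pair $\mathbf A=(A(a),A(b))$ acts on $\mathbb F_q[x,y]$ by $\mathbf A\circ g:=g(ax,by)$. $F_n$ is the set of polynomials in $\mathbb F_q[x,y]$ that are zero or homogeneous of degree $n$, and $F_n(\mathbf A):=\{g\in F_n:\mathbf A\circ g=g\}$. Every $g\in F_n$ can be written uniquely as $g=y^nf(x/y)$ with $f\in\mathbb F_q[t]$ of degree at most $n$. *)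

(* Defs.v *)
From HB Require Import structures.
From mathcomp Require Import all_boot all_order all_algebra.
From mathcomp Require Import mpoly.

Set Implicit Arguments.
Unset Strict Implicit.
Unset Printing Implicit Defensive.

Import GRing.Theory.
Local Open Scope ring_scope.

(* The bivariate polynomial ring F[x, y] is {mpoly F[2]}. *)
Definition varx {F : fieldType} : {mpoly F[2]} := 'X_(0 : 'I_2).
Definition vary {F : fieldType} : {mpoly F[2]} := 'X_(1 : 'I_2).

Definition matA {F : fieldType} (a : F) : 'M[F]_2 :=
  diag_mx (\row_(j < 2) (if j == 0 then a else 1)).

(* Used only for M = (matA a, matA b), where the top left entries are a and b,
   so that act M g is g(a x, b y). *)
Definition act {F : fieldType} (M : 'M[F]_2 * 'M[F]_2) (g : {mpoly F[2]}) :
    {mpoly F[2]} :=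
  g \mPo [tuple M.1 0 0 *: varx; M.2 0 0 *: vary].

(* The zero polynomial is n.-homog for every n. *)
Definition Fn {F : fieldType} (n : nat) : pred {mpoly F[2]} :=
  [pred g | g \is n.-homog].

Definition FnA {F : fieldType} (n : nat) (M : 'M[F]_2 * 'M[F]_2) :
    pred {mpoly F[2]} :=
  [pred g | (g \in Fn n) && (act M g == g)].

(* y^n f(x/y), computed in the field of fractions F(x, y). *)
Definition ynf {F : fieldType} (n : nat) (f : {poly F}) :
    {fraction {mpoly F[2]}} :=
  tofrac vary ^+ n *
  (map_poly (fun c : F => tofrac (c%:MP : {mpoly F[2]})) f)
    .[tofrac varx / tofrac vary].

(* polydiv's irreducible_poly only covers univariate polynomials. *)
Definition irreducible_elt {R : idomainType} (p : R) : Prop :=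
  [/\ p != 0, p \isn't a GRing.unit
    & forall u v : R, p = u * v ->
        u \is a GRing.unit \/ v \is a GRing.unit].

(* Main.v *)
(** The ring embedding x |-> t z, y |-> z of F[x, y] into F[t][z] sends
    y^n f(x/y) to f(t) z^n.  A factor of a monomial in z over a domain is again
    a monomial in z, so the factorizations of y^n f(x/y) are exactly the
    products of y^k p(x/y) and y^l q(x/y) with k + l = n, p q = f, deg p <= k and
    deg q <= l.  Invariance is compared coefficientwise; if f is irreducible of
    degree at least 2 then f(0) is nonzero, which forces b^n = 1. *)

Require Import Defs.
From HB Require Import structures.
From mathcomp Require Import all_boot all_order all_algebra.
From mathcomp Require Import mpoly.

Set Implicit Arguments.
Unset Strict Implicit.
Unset Printing Implicit Defensive.

Import GRing.Theory.
Local Open Scope ring_scope.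

(* The inner indeterminate is t, the outer one z. *)
Definition grdehom {F : fieldType} : {mpoly F[2]} -> {poly {poly F}} :=
  mmap (polyC \o polyC) (fun i : 'I_2 => if i == 0 then 'X%:P * 'X else 'X).

HB.instance Definition _ (F : fieldType) := GRing.RMorphism.on (@grdehom F).

(** This is y^n p(x/y) written without fractions. Terms of [p] of degree above [n] are dropped, so
    the bound [size p <= n.+1] accompanies it below. *)
Definition homogenize {F : fieldType} (n : nat) (p : {poly F}) : {mpoly F[2]} :=
  \sum_(i < n.+1) p`_i *: (varx ^+ i * vary ^+ (n - i)).

(** Induction on [n]: the product vanishes at 0, so one factor does, and an ['X] can be cancelled
    from it. For [n = 0] both factors are constants by size. It is applied with R = F[t] and [c] a
    polynomial in t. *)
Lemma polyM_eq_Xn (R : idomainType) (c : R) (p q : {poly R}) n : c != 0 ->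
  p * q = c%:P * 'X^n ->
  exists d e k l,
    [/\ p = d%:P * 'X^k, q = e%:P * 'X^l, (k + l)%N = n & d * e = c].
Proof.
move=> c0; elim: n p q => [|n IHn] p q pq.
  rewrite expr0 mulr1 in pq.
  have pq0 : p * q != 0 by rewrite pq polyC_eq0.
  have [p0 q0] : p != 0 /\ q != 0.
    by apply/andP; rewrite -negb_or -mulf_eq0.
  have := congr1 (fun r : {poly R} => size r) pq.
  rewrite size_mul // size_polyC c0 => spq.
  have [sp sq] : (size p <= 1)%N /\ (size q <= 1)%N.
    move: spq p0 q0; rewrite -!size_poly_gt0.
    by case: (size p) => [|[|i]]; case: (size q) => [|[|j]] //=; rewrite ?addnS.
  exists p`_0, q`_0, 0, 0; rewrite !expr0 !mulr1 -!size1_polyC //; split=> //.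
  by rewrite -coef0M pq coefC.
have /eqP : (p * q).[0] = 0 by rewrite pq exprSr mulrA hornerMX mulr0.
have XI : injective (fun r : {poly R} => r * 'X).
  by apply: mulIf; rewrite polyX_eq0.
rewrite hornerM mulf_eq0 => /orP[] /factor_theorem[r]; rewrite subr0 => rE.
  have [|d [e [k [l [pE qE kl de]]]]] := IHn r q.
    by apply: XI; rewrite /= mulrAC -rE pq exprSr mulrA.
  by exists d, e, k.+1, l; rewrite rE pE exprSr mulrA addSn kl.
have [|d [e [k [l [pE qE kl de]]]]] := IHn p r.
  by apply: XI; rewrite /= -mulrA -rE pq exprSr mulrA.
by exists d, e, k, l.+1; rewrite rE qE exprSr mulrA addnS kl.
Qed.

(** * The embedding into F[t][z] and homogenization *)

Section GradedDehomogenization.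
Variable F : fieldType.
Implicit Types (c : F) (p q : {poly F}) (g u v : {mpoly F[2]}) (k n : nat).

Lemma grdehom_varx : grdehom varx = 'X%:P * 'X :> {poly {poly F}}.
Proof. by rewrite /grdehom mmapX mmap1U. Qed.

Lemma grdehom_vary : grdehom vary = 'X :> {poly {poly F}}.
Proof. by rewrite /grdehom mmapX mmap1U. Qed.

Lemma grdehomZ c g : grdehom (c *: g) = c%:P%:P * grdehom g.
Proof. by rewrite /grdehom mmapZ. Qed.

(** The monomial x^i y^j goes to t^i z^(i+j): the power of z records the total degree, the power of
    t the exponent of x. *)
Lemma coef_grdehom g k :
  (grdehom g)`_k = \sum_(m <- msupp g | mdeg m == k) g@_m *: 'X^(m 0).
Proof.
rewrite /grdehom /mmap coef_sum [RHS]big_mkcond; apply: eq_bigr => m _.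
rewrite /mmap1 !big_ord_recl big_ord0 mulr1 /= exprMn -mulrA -exprD.
rewrite -rmorphXn mulrA -rmorphM coefCM coefXn mulr_natr mul_polyC.
rewrite mdegE !big_ord_recl big_ord0 addn0 eq_sym.
by case: eqP => _; rewrite ?mulr1n ?mulr0n.
Qed.

Lemma size_coef_grdehom g k : (size ((grdehom g)`_k)%R <= k.+1)%N.
Proof.
rewrite coef_grdehom; apply: (leq_trans (size_sum _ _ _)).
apply/bigmax_leqP_seq => m _ /eqP <-.
rewrite (leq_trans (size_scale_leq _ _)) // size_polyXn ltnS mdegE.
by rewrite big_ord_recl leq_addr.
Qed.

Lemma mcoeff_grdehom g (m : 'X_{1..2}) : g@_m = (grdehom g)`_(mdeg m)`_(m 0).
Proof.
rewrite coef_grdehom coef_sum.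
(* With two variables, the total degree and the first exponent determine the second one. *)
have mE (m' : 'X_{1..2}) : mdeg m' == mdeg m -> (m 0 == m' 0%R) = (m' == m).
  rewrite !mdegE !big_ord_recl !big_ord0 !addn0 => /eqP e.
  apply/eqP/eqP => [e0|-> //]; apply/mnmP => i.
  move: e; rewrite -e0 => /addnI e1.
  by case: (unliftP ord0 i) => [j|] ->; rewrite ?(ord1 j).
transitivity (\sum_(m' <- msupp g | m' == m) g@_m').
  rewrite -big_filter; case: (boolP (m \in msupp g)) => hm.
    by rewrite filter_pred1_uniq // big_seq1.
  rewrite (memN_msupp_eq0 hm) big_seq big1 // => m'.
  by rewrite mem_filter => /andP[/eqP ->]; rewrite (negPf hm).
rewrite big_mkcond [RHS]big_mkcond; apply: eq_bigr => m' _.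
case: ifP => [/eqP ->|ne]; first by rewrite eqxx coefZ coefXn eqxx mulr1.
by case: ifP => // /mE e; rewrite coefZ coefXn e ne mulr0.
Qed.

Lemma grdehom_inj : injective (@grdehom F).
Proof. by move=> u v e; apply/mpolyP => m; rewrite !mcoeff_grdehom e. Qed.

Lemma grdehom_homogenize n p :
  (size p <= n.+1)%N -> grdehom (homogenize n p) = p%:P * 'X^n.
Proof.
move=> hp; have {2}-> : p = \sum_(i < n.+1) p`_i *: 'X^i.
  rewrite -poly_def; apply/polyP => i; rewrite coef_poly.
  by case: ltnP => // hi; rewrite nth_default // (leq_trans hp).
rewrite !rmorph_sum mulr_suml; apply: eq_bigr => i _.
rewrite /= grdehomZ rmorphM !rmorphXn /= grdehom_varx grdehom_vary.
rewrite exprMn -mulrA -exprD.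
by rewrite subnKC -1?ltnS // -mul_polyC rmorphM mulrA rmorphXn.
Qed.

(** Termwise y^n (x/y)^i = x^i y^(n-i), as i <= n and y is nonzero. This carries the hypothesis on
    [ynf] back to polynomials. *)
Lemma tofrac_homogenize n p :
  (size p <= n.+1)%N -> tofrac (homogenize n p) = ynf n p.
Proof.
move=> hp; rewrite /ynf (@horner_coef_wide _ n.+1); last first.
  exact: leq_trans (size_poly _ _) hp.
rewrite mulr_sumr /homogenize raddf_sum; apply: eq_bigr => i _.
rewrite coef_map_id0 ?mpolyC0 ?tofrac0 //.
have y0 : tofrac vary != 0 :> {fraction {mpoly F[2]}}.
  by rewrite tofrac_eq0 /vary -msupp_eq0 msuppX.
rewrite -mul_mpolyC /= !tofracM !tofracXn expr_div_n.
have -> : tofrac vary ^+ n = tofrac vary ^+ i * tofrac vary ^+ (n - i)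
    :> {fraction {mpoly F[2]}} by rewrite -exprD subnKC -1?ltnS.
move: (tofrac vary) y0 => y y0.
rewrite [RHS]mulrCA; congr (_ * _); rewrite [RHS]mulrCA; congr (_ * _).
by rewrite [RHS]mulrC mulKf ?expf_neq0.
Qed.

Lemma homogenize_inj n p q : (size p <= n.+1)%N -> (size q <= n.+1)%N ->
  homogenize n p = homogenize n q -> p = q.
Proof.
move=> hp hq /(congr1 grdehom); rewrite !grdehom_homogenize // => e.
by apply/polyC_inj/(mulIf _ e); rewrite expf_neq0 // polyX_eq0.
Qed.

Lemma homogenizeM k n p q : (size p <= k.+1)%N -> (size q <= n.+1)%N ->
  homogenize (k + n) (p * q) = homogenize k p * homogenize n q.
Proof.
move=> hp hq; apply: grdehom_inj.
have hpq : (size (p * q)%R <= (k + n).+1)%N.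
  apply: leq_trans (size_polyMleq _ _) _; rewrite -subn1 leq_subLR addnS add1n.
  by rewrite -addSn -addnS leq_add.
by rewrite rmorphM /= !grdehom_homogenize // rmorphM exprD mulrACA.
Qed.

(** * The diagonal action on forms *)

Lemma coef_comp_polyZX c p i : (p \Po (c *: 'X))`_i = c ^+ i * p`_i.
Proof.
rewrite coef_comp_poly.
under eq_bigr do rewrite exprZn coefZ coefXn.
case: (ltnP i (size p)) => hi; last first.
  rewrite nth_default // mulr0 big1 // => j _.
  by rewrite gtn_eqF ?mulr0 // (leq_trans (ltn_ord j)).
rewrite (bigD1 (Ordinal hi)) //= eqxx mulr1 big1 ?addr0 1?mulrC // => j.
by rewrite -val_eqE eq_sym /= => /negPf ->; rewrite !mulr0.
Qed.

(** The identity a^i b^(n-i) = b^n (a/b)^i turns the action on degree-n forms into the scaling of t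
    by a/b, up to the factor b^n. *)
Lemma act_homogenize (a b : F) n p : b != 0 -> (size p <= n.+1)%N ->
  act (matA a, matA b) (homogenize n p) =
  homogenize n (b ^+ n *: (p \Po ((a * b^-1) *: 'X))).
Proof.
move=> b0 hp; rewrite /act /homogenize raddf_sum; apply: eq_bigr => i _ /=.
rewrite comp_mpolyZ rmorphM !rmorphXn /= !comp_mpolyXU /=.
rewrite !mxE eqxx !mulr1n !exprZn -scalerAl -scalerAr !scalerA.
congr (_ *: _); rewrite coefZ coef_comp_polyZX expr_div_n.
have -> : b ^+ n = b ^+ i * b ^+ (n - i) by rewrite -exprD subnKC -1?ltnS.
rewrite mulrACA (mulrC (b ^+ i)) mulrACA mulrA.
by rewrite [_ / _ * _ * _]mulrAC divfK ?expf_neq0 // [RHS]mulrC mulrA.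
Qed.

(** * Units and irreducibility of forms *)

Lemma grdehom_unit u : (grdehom u \is a GRing.unit) = (u \is a GRing.unit).
Proof.
apply/idP/idP=> [|uU]; last by apply: rmorph_unit.
rewrite poly_unitE => /andP[/eqP /eq_leq /size1_polyC e].
rewrite poly_unitE => /andP[/eqP /eq_leq /size1_polyC e1 uc].
have -> : u = ((grdehom u)`_0`_0)%:MP.
  by apply: grdehom_inj; rewrite [LHS]e [in LHS]e1 /grdehom mmapC.
exact: rmorph_unit.
Qed.

Lemma homogenize_unit n p : (size p <= n.+1)%N ->
  homogenize n p \is a GRing.unit -> n = 0.
Proof.
move=> hp; rewrite -grdehom_unit grdehom_homogenize // poly_unitE.
case: (eqVneq p 0) => [->|p0]; first by rewrite mul0r size_poly0.
by rewrite size_Cmul // size_polyXn eqSS => /andP[/eqP].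
Qed.

Lemma irreducible_homogenize n p : (2 <= n)%N -> (size p <= n.+1)%N ->
  p != 0 ->
  irreducible_elt (homogenize n p) <-> irreducible_poly p /\ size p = n.+1.
Proof.
move=> n2 hp p0; split=> [[g0 gU gI]|[[p1 pI] sp]].
  have sp : size p = n.+1.
    apply/eqP; rewrite eqn_leq hp ltnNge; apply/negP => hp'.
    case: n n2 hp' gI {hp g0 gU} => // n n2 hp' gI.
    (* [homogenize 1 1] is y: if [p] had degree below the weight, y would split off, and neither
       factor is a unit since the weight is at least 2. *)
    have e : homogenize n.+1 p = homogenize 1 1 * homogenize n p.
      by rewrite -homogenizeM ?mul1r ?size_poly1.
    case: (gI _ _ e) => /homogenize_unit; rewrite ?size_poly1 => h.
      by have := h isT.
    by rewrite (h hp') in n2.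
  split=> //; split; first by rewrite sp ltnS ltnW.
  move=> q q1 /dvdpP[r pE].
  have r0 : r != 0 by apply: contraNneq p0 => r0; rewrite pE r0 mul0r.
  have q0 : q != 0 by apply: contraNneq p0 => q0; rewrite pE q0 mulr0.
  have [rs qs] : (0 < size r)%N /\ (0 < size q)%N by rewrite !size_poly_gt0.
  have nE : n = ((size r).-1 + (size q).-1)%N.
    move: sp; rewrite pE size_mul //.
    case: (size r) rs => // i _; case: (size q) qs => // j _.
    by rewrite addnS => -[].
  (* Both factors are homogenized at their exact degrees, so a unit among them comes from a
     constant. *)
  have [||] := gI (homogenize (size r).-1 r) (homogenize (size q).-1 q).
  - by rewrite -homogenizeM ?prednK // -pE -nE.
  - move/homogenize_unit; rewrite prednK // leqnn => /(_ isT) r1.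
    by rewrite -dvdp_size_eqp ?pE ?dvdp_mulIr // -pE sp nE r1 add0n prednK.
  - move/homogenize_unit; rewrite prednK // leqnn => /(_ isT) q1'.
    by rewrite -(prednK qs) q1' in q1.
split.
- rewrite -(inj_eq grdehom_inj) grdehom_homogenize // rmorph0.
  by rewrite mulf_neq0 ?polyC_eq0 // expf_neq0 // polyX_eq0.
- by apply/negP => /(homogenize_unit hp) n0; rewrite n0 in n2.
move=> u v /(congr1 grdehom); rewrite grdehom_homogenize // rmorphM.
move/esym/(polyM_eq_Xn p0) => [d [e [k [l [uE vE kl de]]]]].
(* If [q] is constant, [r] has full degree n; its bound [j] then leaves i = 0, so the image of [w]
   is a nonzero constant. *)
have unitl (w : {mpoly F[2]}) (q r : {poly F}) i j :
    grdehom w = q%:P * 'X^i -> (size r <= j.+1)%N -> (i + j)%N = n ->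
    q * r = p -> size q = 1%N -> w \is a GRing.unit.
  move=> wE rj ij qr q1.
  have [q0 r0] : q != 0 /\ r != 0.
    by apply/andP; rewrite -negb_or -mulf_eq0 qr.
  have i0 : i = 0.
    move: sp; rewrite -qr size_mul // q1 add1n /= => rE.
    move: rj; rewrite rE -ij ltnS -{2}(add0n j) leq_add2r.
    by rewrite leqn0 => /eqP.
  rewrite -grdehom_unit wE i0 expr0 mulr1 rmorph_unit //.
  rewrite poly_unitE q1 eqxx /= unitfE.
  have -> : q`_0 = lead_coef q by rewrite lead_coefE q1.
  by rewrite lead_coef_eq0 -size_poly_gt0 q1.
(* In any image under the embedding, the coefficient of z^l has degree at most l in t. *)
have ul : (size e <= l.+1)%N.
  by have := size_coef_grdehom v l; rewrite vE coefCM coefXn eqxx mulr1.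
have uk : (size d <= k.+1)%N.
  by have := size_coef_grdehom u k; rewrite uE coefCM coefXn eqxx mulr1.
have [d1|d1] := eqVneq (size d) 1%N.
  by left; exact: unitl uE ul kl de d1.
have /eqp_size sd : d %= p by apply: pI; rewrite // -de dvdp_mulIl.
have [d0 e0] : d != 0 /\ e != 0 by apply/andP; rewrite -negb_or -mulf_eq0 de.
(* Here [d] is associate to [p], so [e] is constant and the factors exchange roles. *)
right; apply: (unitl v e d l k) => //; rewrite 1?addnC 1?mulrC //.
move: (sp); rewrite -{1}de size_mul // sd sp addSn /=.
by move/eqP; rewrite -addn1 eqn_add2l => /eqP.
Qed.
End GradedDehomogenization.

(** * Invariance and the irreducible case *)

Theorem lemma6p1 (F : finFieldType) (a b : F) (ha : a != 0) (hb : b != 0)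
    (n : nat) (g : {mpoly F[2]}) (hg : g \in Fn n) (hg0 : g != 0)
    (f : {poly F}) (hf : (size f <= n.+1)%N) (hgf : tofrac g = ynf n f) :
  let M := (matA a, matA b) in
  let c := a * b^-1 in
  (g \in FnA n M <-> b ^- n *: f = f \Po (c *: 'X))
  /\ ((2 <= n)%N ->
      (irreducible_elt g /\ g \in FnA n M <->
       [/\ irreducible_poly f, size f = n.+1, b ^+ n = 1
         & f = f \Po (c *: 'X)])).
Proof.
move=> M c.
have gE : g = homogenize n f.
  apply/eqP; rewrite -subr_eq0 -tofrac_eq0 tofracB hgf.
  by rewrite -tofrac_homogenize // subrr.
have f0 : f != 0.
  apply: contraNneq hg0 => f0; rewrite gE f0 /homogenize big1 // => i _.
  by rewrite coef0 scale0r.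
have bn0 : b ^+ n != 0 by rewrite expf_neq0.
have sfc : (size (b ^+ n *: (f \Po (c *: 'X)))%R <= n.+1)%N.
  rewrite (leq_trans (size_scale_leq _ _)) //; apply/leq_sizeP => j nj.
  by rewrite coef_comp_polyZX nth_default ?mulr0 // (leq_trans hf).
have inv : g \in FnA n M <-> b ^- n *: f = f \Po (c *: 'X).
  rewrite inE hg /= gE act_homogenize //; split=> [/eqP /homogenize_inj e | <-].
    by rewrite -{1}e // scalerA mulVf // scale1r.
  by rewrite scalerA mulfV // scale1r.
split=> // n2; rewrite gE irreducible_homogenize // -gE inv.
split=> [[[fI sf] fE]|[fI sf bn1 fE]]; last by rewrite bn1 invr1 scale1r.
(* Otherwise ['X] divides the irreducible [f], which is then associate to ['X] and has degree 1. *)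
have fc0 : f`_0 != 0.
  apply/negP => /eqP f00; have /(fI.2 _ _) : 'X %| f.
    by rewrite -['X]subr0 dvdp_XsubCl rootE horner_coef0 f00.
  rewrite size_polyX => /(_ isT) /eqp_size; rewrite size_polyX sf => -[n1].
  by rewrite -n1 in n2.
have bn1 : b ^+ n = 1.
  (* Scaling t fixes the constant coefficient, so b^(-n) f(0) = f(0), and f(0) cancels. *)
  have /eqP := congr1 (fun r : {poly F} => r`_0) fE.
  rewrite coefZ coef_comp_polyZX expr0 (inj_eq (mulIf fc0)) => /eqP e.
  by rewrite -[LHS]invrK e invr1.
by split=> //; rewrite -fE bn1 invr1 scale1r.
Qed.
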